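(* Let $c\in\mathbb{C}\setminus\{0\}$, $\beta\in\mathbb{C}$, $\mu\in\mathbb{C}$ and $x\in\{0,1,2,\dots\}$. Then the fractional Meixner function $M_\mu(x;\beta,c)$ satisfies $$M_\mu(x;\beta,c)=\frac{\Gamma(\beta)\,\Gamma(\beta+\mu+x)}{\Gamma(\beta+x)\,\Gamma(\beta+\mu)}\sum_{j=0}^{x}\frac{(-\mu)_j(-x)_j}{j!\,(-\beta-\mu-x+1)_j}\left(\frac1c\right)^j .$$
   Context: For integer index $j\ge0$, $(z)_0=1$ and $(z)_j=z(z+1)\cdots(z+j-1)$. $\Gamma$ is the Gamma function. Gray--Zhang fractional difference: for $\mu\in\mathbb{C}$, an integer $b$ and an integer $t\ge b$, the $\mu$-th order difference of $f$ over $\{b,b+1,\dots,t\}$ is $$\nabla_{b,t}^{\mu}f(t)=\frac{1}{\Gamma(n-\mu)}\nabla^n\left[\sum_{k=b}^{t}(t-k+1)_{n-\mu-1}f(k)\right],$$ where $n=\max\{0,n_0\}$, $n_0$ is the integer with $0<\mathrm{Re}(n_0-\mu)\le1$, $\nabla g(t)=g(t)-g(t-1)$ acts on the bracket as a function of $t$ (a sum with upper limit smaller than $b$ being $0$), and for complex index $s$, $(z)_s=\Gamma(z+s)/\Gamma(z)$ when $z$ and $z+s$ are not in $\{0,-1,-2,\dots\}$. The fractional Meixner function is defined, for $c\in\mathbb{C}\setminus\{0\}$, $\beta,\mu\in\mathbb{C}$ and $x\in\{0,1,2,\dots\}$, by $$M_\mu(x;\beta,c)=\frac{x!}{c^x(\beta)_x}\,\nabla_{0,x}^{\mu}\left[\frac{(\beta+\mu)_x\,c^x}{x!}\right],$$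 i.e. using the $\mu$-th order difference over $\{0,1,\dots,x\}$ of the function $k\mapsto(\beta+\mu)_k c^k/k!$, evaluated at $x$. *)

(* Defs.v *)
From Stdlib Require Import Reals ZArith.
From Coquelicot Require Import Coquelicot.

Open Scope C_scope.

Definition nabla (g : Z -> C) (t : Z) : C := g t - g (t - 1)%Z.

(* (z)_j for an integer index j >= 0. *)
Fixpoint poch (z : C) (j : nat) : C :=
  match j with
  | O => 1
  | S i => poch z i * (z + INR i)
  end.

(* t^s for real t > 0 and complex s (principal branch). *)
Definition pos_Cpow (t : R) (s : C) : C :=
  exp (Re s * ln t) * (cos (Im s * ln t), sin (Im s * ln t)).

Definition Gamma_defined (z : C) : Prop := forall m : nat, z <> - INR m.

(* The Gamma function on all of C minus {0, -1, -2, ...}, as Euler's limit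
   Gamma(z) = lim_k k! k^(z-1) / (z)_k, see Andrews, Askey and Roy,
   "Special Functions", Def. 1.1.1; junk value at the poles. *)
Definition Gamma (z : C) : C :=
  iota (T := C_R_CompleteNormedModule) (fun l : C =>
    filterlim
      (fun k : nat => INR (fact k) * pos_Cpow (INR k) (z - 1) / poch z k)
      eventually (locally l)).

(* (z)_s for a complex index s, when z and z + s are not poles of Gamma. *)
Definition Cpoch (z s : C) : C := Gamma (z + s) / Gamma z.

(* sum_{k=b}^t F(k), equal to 0 when t < b. *)
Definition Zsum (b t : Z) (F : Z -> C) : C :=
  if (t <? b)%Z then 0
  else sum_n (fun i : nat => F (b + Z.of_nat i)%Z) (Z.to_nat (t - b)).

(* n = max{0, n0} with 0 < Re(n0 - mu) <= 1: [up r] is the integer with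
   r < up r <= r + 1, and [Z.to_nat] sends negative integers to 0. *)
Definition diff_order (mu : C) : nat := Z.to_nat (up (Re mu)).

(* The mu-th order difference of f over {b, ..., t}, meant for b <= t; only the
   values of f on {b, ..., t} are used. *)
Definition frac_nabla (mu : C) (b : Z) (f : Z -> C) (t : Z) : C :=
  let n := diff_order mu in
  / Gamma (INR n - mu) *
  Nat.iter n nabla
    (fun s : Z =>
       Zsum b s (fun k : Z => Cpoch (IZR (s - k + 1)) (INR n - mu - 1) * f k))
    t.

Definition frac_Meixner (mu : C) (x : nat) (beta c : C) : C :=
  INR (fact x) / (c ^ x * poch beta x) *
  frac_nabla mu 0
    (fun k : Z => poch (beta + mu) (Z.to_nat k) * c ^ Z.to_nat k
                  / INR (fact (Z.to_nat k)))
    (Z.of_nat x).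

(* Main.v *)
Require Import Defs.
From Stdlib Require Import Reals ZArith Lra Lia Classical.
From Coquelicot Require Import Coquelicot.

Open Scope C_scope.

(** The identity is a reversal of summation, once the fractional difference is
    made explicit.  Put [frac_coef a j := (a)_j / j!], the coefficient of [X^j]
    in [(1 - X)^(-a)].  The weights [(t-k+1)_(n-mu-1)] of the fractional
    difference are [Gamma (n - mu)] times [frac_coef (n - mu) (t - k)], because
    [Gamma (z + m) = (z)_m Gamma z] and [Gamma (m + 1) = m!].  So, after the
    division by [Gamma (n - mu)], the bracket is the convolution of [f] with
    the coefficients of [(1 - X)^(mu - n)].  One backward difference multiplies
    the generating function by [1 - X] (Pascal's rule, [frac_coef_pascal]), and
    [n] of them leave the convolution of [f] with the coefficients of
    [(1 - X)^mu], whatever [n] is: this is [frac_nabla_frac_sum].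

    Read backwards ([j := x - k]), that convolution gives for the fractional
    Meixner function the sum [Meixner_sum], a polynomial in [beta] divided by
    [(beta)_x].  On the other side, the quotient of Gamma factors is
    [(b + mu)_x / (b)_x], and the Pochhammer symbols of negative argument turn
    into [x! / (x-j)!] and [(b + mu)_x / (b + mu)_(x-j)] up to the same sign
    [(-1)^j] ([poch_neg_INR], [poch_reflect]), which yields the same sum.  That
    proves the equality away from the poles.  Since the poles are isolated and
    [Meixner_sum] is continuous where [(beta)_x <> 0], the limit statement
    follows.

    The analytic input is that Euler's limit exists, does not vanish, and obeys
    [Gamma (z + 1) = z Gamma z].  Consecutive terms of Euler's sequence have
    ratio [(1 + 1/k)^z / (1 + z/k) = 1 + O(1/k^2)], and a sequence with such
    ratios has a nonzero limit ([slowly_varying_limit]). *)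

(** * Limits in the complex plane *)

(** The product topology and the one given by the modulus are two different
    structures on [C]; multiplication is known to be continuous for the second
    one, whereas the notation [locally] on [C] selects the first one. *)
Lemma filterlim_C_AbsRing {T : Type} (F : (T -> Prop) -> Prop) (f : T -> C) (l : C) :
  filterlim f F (@locally C_UniformSpace l) <->
  filterlim f F (@locally (AbsRing_UniformSpace C_AbsRing) l).
Proof.
  split; intros H P HP; apply H; revert HP; apply locally_C.
Qed.

Lemma filterlim_C_Cmod {T : Type} (F : (T -> Prop) -> Prop) {FF : Filter F}
    (f : T -> C) (l : C) :
  filterlim f F (@locally C_UniformSpace l) <->
  forall eps : R, (0 < eps)%R -> F (fun t => (Cmod (f t - l) < eps)%R).
Proof.
  rewrite filterlim_C_AbsRing.
  etransitivity; [exact (filterlim_locally (U := AbsRing_UniformSpace C_AbsRing) f l) |].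
  split.
  - intros H eps Heps. exact (H (mkposreal eps Heps)).
  - intros H eps. exact (H eps (cond_pos eps)).
Qed.

Lemma filterlim_C_mult {T : Type} (F : (T -> Prop) -> Prop) {FF : Filter F}
    (f g : T -> C) (a b : C) :
  filterlim f F (locally a) -> filterlim g F (locally b) ->
  filterlim (fun t => f t * g t) F (locally (a * b)).
Proof.
  rewrite 3!filterlim_C_AbsRing. intros Hf Hg.
  exact (filterlim_comp_2 _ _ _ Hf Hg (filterlim_mult (K := C_AbsRing) a b)).
Qed.

Lemma filterlim_C_plus {T : Type} (F : (T -> Prop) -> Prop) {FF : Filter F}
    (f g : T -> C) (a b : C) :
  filterlim f F (locally a) -> filterlim g F (locally b) ->
  filterlim (fun t => f t + g t) F (locally (a + b)).
Proof.
  intros Hf Hg.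
  exact (filterlim_comp_2 _ _ _ Hf Hg (filterlim_plus (V := C_R_NormedModule) a b)).
Qed.

Lemma filterlim_C_inv {T : Type} (F : (T -> Prop) -> Prop) {FF : Filter F}
    (f : T -> C) (a : C) :
  a <> 0 -> filterlim f F (locally a) ->
  filterlim (fun t => / f t) F (locally (/ a)).
Proof.
  intros Ha. rewrite 2!(filterlim_C_Cmod F). intros Hf eps Heps.
  assert (Hm : (0 < Cmod a)%R) by now apply Cmod_gt_0.
  assert (Hd : (0 < Rmin (Cmod a / 2) (eps * Cmod a * Cmod a / 2))%R).
  { apply Rmin_pos; [lra|]. assert (0 < eps * Cmod a * Cmod a)%R; [|lra].
    repeat apply Rmult_lt_0_compat; assumption. }
  generalize (Hf _ Hd). apply filter_imp. intros t Ht.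
  assert (H1 : (Cmod (f t - a) < Cmod a / 2)%R)
    by (eapply Rlt_le_trans; [exact Ht | apply Rmin_l]).
  assert (H2 : (Cmod (f t - a) < eps * Cmod a * Cmod a / 2)%R)
    by (eapply Rlt_le_trans; [exact Ht | apply Rmin_r]).
  assert (H3 : (Cmod a / 2 < Cmod (f t))%R).
  { assert (Cmod a <= Cmod (f t) + Cmod (f t - a))%R; [|lra].
    replace a with (f t + - (f t - a)) at 1 by ring.
    rewrite <- (Cmod_opp (f t - a)). apply Cmod_triangle. }
  assert (Hft : f t <> 0) by (apply Cmod_gt_0; lra).
  replace (/ f t - / a) with (- (f t - a) / (f t * a)) by (field; auto).
  rewrite Cmod_div, Cmod_opp, Cmod_mult by (now apply Cmult_neq_0).
  apply Rmult_lt_reg_r with (Cmod (f t) * Cmod a)%R.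
  { apply Rmult_lt_0_compat; lra. }
  unfold Rdiv. rewrite Rmult_assoc, Rinv_l, Rmult_1_r
    by (apply Rgt_not_eq, Rmult_lt_0_compat; lra).
  apply Rlt_trans with (1 := H2).
  assert (0 < eps * Cmod a)%R by (apply Rmult_lt_0_compat; lra).
  nra.
Qed.

(** * First-order estimate of a complex power *)

(** The upper bound comes from [exp s <= 1 / (1 - s)], that is, from
    [1 + y <= exp y] at [y = - s]. *)
Lemma exp_first_order (s : R) :
  (Rabs s <= 1 / 2 -> 0 <= exp s - 1 - s <= 2 * s ^ 2)%R.
Proof.
  intros Hs. apply Rabs_le_between in Hs.
  assert (H1 := exp_ineq1_le s). assert (H2 := exp_ineq1_le (- s)).
  split; [lra|].
  assert (H3 : (exp s * exp (- s) = 1)%R).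
  { rewrite <- exp_plus, Rplus_opp_r. apply exp_0. }
  assert (H4 := exp_pos s).
  assert (H5 : (exp s * (1 - s) <= 1)%R).
  { rewrite <- H3. apply Rmult_le_compat_l; lra. }
  apply Rmult_le_reg_r with (1 - s)%R; [lra|].
  nra.
Qed.

Lemma Rabs_sin_le (t : R) : (Rabs (sin t) <= Rabs t)%R.
Proof.
  destruct (MVT_gen sin 0 t cos) as [c [_ Hc]].
  - intros; auto_derive; [trivial | ring].
  - intros; apply continuity_sin.
  - rewrite sin_0, 2!Rminus_0_r in Hc. rewrite Hc, Rabs_mult.
    assert (H := COS_bound c). assert (H' := Rabs_pos t).
    assert (Rabs (cos c) <= 1)%R by (apply Rabs_le; lra). nra.
Qed.

Lemma cos_first_order (t : R) : (0 <= 1 - cos t <= t ^ 2)%R.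
Proof.
  assert (H := COS_bound t). split; [lra|].
  replace t with (2 * (t / 2))%R at 1 by field.
  rewrite cos_2a_sin.
  assert (Hs := Rabs_sin_le (t / 2)). apply Rsqr_le_abs_1 in Hs.
  unfold Rsqr in Hs. assert (0 <= t * t)%R by nra. lra.
Qed.

Lemma sin_first_order (t : R) : (Rabs t <= 1 -> Rabs (sin t - t) <= t ^ 2)%R.
Proof.
  intros Ht.
  destruct (MVT_gen (fun y => sin y - y)%R 0 t (fun y => cos y - 1)%R)
    as [c [Hc1 Hc]].
  - intros; auto_derive; [trivial | ring].
  - intros. apply continuity_pt_minus; [apply continuity_sin |].
    apply continuity_pt_id.
  - rewrite sin_0 in Hc. replace (sin t - t)%R with ((cos c - 1) * t)%R by lra.
    assert (H := cos_first_order c).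
    assert (Hct : (Rabs c <= Rabs t)%R).
    { revert Hc1. unfold Rmin, Rmax, Rabs. repeat destruct Rle_dec;
      repeat destruct Rcase_abs; lra. }
    rewrite Rabs_mult, <- Rabs_Ropp.
    rewrite (Rabs_pos_eq (- (cos c - 1))) by lra.
    assert (c ^ 2 <= Rabs t)%R.
    { rewrite <- pow2_abs. assert (Hc0 := Rabs_pos c). nra. }
    rewrite <- (pow2_abs t). assert (Ht0 := Rabs_pos t). nra.
Qed.

Lemma ln_first_order (h : R) : (0 < h <= 1 -> 0 <= h - ln (1 + h) <= h ^ 2)%R.
Proof.
  intros Hh. split.
  - assert (ln (1 + h) <= h)%R; [|lra].
    rewrite <- (ln_exp h) at 2. apply ln_le; [lra | apply exp_ineq1_le].
  - assert (h / (1 + h) <= ln (1 + h))%R.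
    { apply Ropp_le_cancel. rewrite <- ln_Rinv by lra.
      rewrite <- (ln_exp (- (h / (1 + h)))).
      apply ln_le; [apply Rinv_0_lt_compat; lra|].
      replace (/ (1 + h))%R with (1 + - (h / (1 + h)))%R by (field; lra).
      apply exp_ineq1_le. }
    assert (h - h / (1 + h) = h ^ 2 / (1 + h))%R by (field; lra).
    assert (h ^ 2 / (1 + h) <= h ^ 2)%R; [|lra].
    apply Rle_div_l; [lra | nra].
Qed.

Lemma Cmod_le_Rabs (z : C) : (Cmod z <= Rabs (Re z) + Rabs (Im z))%R.
Proof.
  replace z with (RtoC (Re z) + Ci * RtoC (Im z)) at 1.
  - eapply Rle_trans; [apply Cmod_triangle|].
    rewrite Cmod_mult, Cmod_Ci, 2!Cmod_R. lra.
  - destruct z as [a b]. apply injective_projections; simpl; ring.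
Qed.

Lemma im_le_Cmod (z : C) : (Rabs (Im z) <= Cmod z)%R.
Proof. eapply Rle_trans; [apply Rmax_r | apply Rmax_Cmod]. Qed.

(** Since [pos_Cpow (exp L) z] is [exp (z L)], this is the second-order
    remainder of the complex exponential, bounded through its real and
    imaginary parts. *)
Lemma pos_Cpow_first_order_exp (z : C) (L : R) :
  (Cmod z * Rabs L <= 1 / 2)%R ->
  (Cmod (pos_Cpow (exp L) z - (1 + z * L)) <= 10 * (Cmod z * Rabs L) ^ 2)%R.
Proof.
  intros HL. unfold pos_Cpow. rewrite ln_exp.
  set (s := (Re z * L)%R). set (t := (Im z * L)%R). set (B := (Cmod z * Rabs L)%R) in *.
  assert (Hs : (Rabs s <= B)%R).
  { unfold s, B. rewrite Rabs_mult. apply Rmult_le_compat_r; [apply Rabs_pos | apply re_le_Cmod]. }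
  assert (Ht : (Rabs t <= B)%R).
  { unfold t, B. rewrite Rabs_mult. apply Rmult_le_compat_r; [apply Rabs_pos | apply im_le_Cmod]. }
  assert (Hs2 : (s ^ 2 <= B ^ 2)%R).
  { rewrite <- pow2_abs. apply pow_incr; split; [apply Rabs_pos | exact Hs]. }
  assert (Ht2 : (t ^ 2 <= B ^ 2)%R).
  { rewrite <- pow2_abs. apply pow_incr; split; [apply Rabs_pos | exact Ht]. }
  assert (He := exp_first_order s ltac:(lra)).
  assert (Hc := cos_first_order t).
  assert (Hn := sin_first_order t ltac:(lra)).
  assert (Hcb := COS_bound t).
  assert (HB : (0 <= B)%R) by (assert (H := Rabs_pos s); lra).
  apply Rabs_le_between in Hs. apply Rabs_le_between in Ht.
  apply Rabs_le_between in Hn.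
  eapply Rle_trans; [apply Cmod_le_Rabs|].
  (* e^s cos t - 1 - s and e^s sin t - t, split into second-order quantities *)
  match goal with |- (Rabs ?x + Rabs ?y <= _)%R =>
    replace x with ((exp s - 1 - s) - exp s * (1 - cos t))%R;
    [replace y with (exp s * (sin t - t) + (exp s - 1) * t)%R |] end.
  2,3: unfold s, t; destruct z; simpl; ring.
  assert (Hes : (0 < exp s <= 2)%R) by (split; [apply exp_pos | nra]).
  assert (Hes1 : (- B <= exp s - 1 <= 2 * B)%R) by nra.
  assert (Rabs (exp s - 1 - s - exp s * (1 - cos t)) <= 4 * B ^ 2)%R.
  { apply Rabs_le. split; nra. }
  assert (Rabs (exp s * (sin t - t) + (exp s - 1) * t) <= 6 * B ^ 2)%R.
  { eapply Rle_trans; [apply Rabs_triang|]. rewrite 2!Rabs_mult.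
    assert (Rabs (exp s) <= 2)%R by (apply Rabs_le; lra).
    assert (Rabs (sin t - t) <= B ^ 2)%R by (apply Rabs_le; lra).
    assert (Rabs (exp s - 1) <= 2 * B)%R by (apply Rabs_le; lra).
    assert (Rabs t <= B)%R by (apply Rabs_le; lra).
    assert (Rabs (exp s) * Rabs (sin t - t) <= 2 * B ^ 2)%R
      by (apply Rmult_le_compat; auto using Rabs_pos).
    assert (Rabs (exp s - 1) * Rabs t <= (2 * B) * B)%R
      by (apply Rmult_le_compat; auto using Rabs_pos).
    lra. }
  lra.
Qed.

Lemma pos_Cpow_first_order (z : C) :
  exists K : R, (0 <= K)%R /\ forall h : R, (0 < h <= 1)%R -> (Cmod z * h <= 1 / 2)%R ->
    (Cmod (pos_Cpow (1 + h) z - (1 + z * h)) <= K * h ^ 2)%R.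
Proof.
  assert (Hz := Cmod_ge_0 z).
  exists (10 * Cmod z ^ 2 + Cmod z)%R. split; [nra|].
  intros h Hh Hzh. set (L := ln (1 + h)).
  assert (HL := ln_first_order h Hh). fold L in HL.
  assert (HL0 : (0 <= L)%R).
  { unfold L. rewrite <- ln_1. apply ln_le; lra. }
  assert (Hexp : exp L = (1 + h)%R) by (apply exp_ln; lra).
  assert (HzL : (Cmod z * Rabs L <= Cmod z * h)%R).
  { rewrite Rabs_pos_eq by assumption. apply Rmult_le_compat_l; lra. }
  assert (H := pos_Cpow_first_order_exp z L ltac:(lra)).
  rewrite Hexp in H.
  replace (pos_Cpow (1 + h) z - (1 + z * h))
    with ((pos_Cpow (1 + h) z - (1 + z * L)) + z * RtoC (L - h)%R)
    by (rewrite RtoC_minus; ring).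
  eapply Rle_trans; [apply Cmod_triangle|].
  rewrite Cmod_mult, Cmod_R, (Rabs_left1 (L - h)) by lra.
  assert ((Cmod z * Rabs L) ^ 2 <= (Cmod z * h) ^ 2)%R.
  { apply pow_incr. split; [|exact HzL].
    apply Rmult_le_pos; [assumption | apply Rabs_pos]. }
  nra.
Qed.

(** * Sequences with ratio 1 + O(1/k^2) *)

(** The sum of [1/k^2] is compared with the telescoping sum of
    [1/(k-1) - 1/k].  From a rank [M] that is large with respect to [K], the
    sequence stays below [2 |u M|] in modulus, so that the relative bound on
    its steps becomes an absolute one; both facts are carried by one
    induction. *)
Lemma slowly_varying_deviation (u : nat -> C) (K : R) (M : nat) :
  (0 <= K)%R -> (2 <= M)%nat -> (4 * K <= INR M - 1)%R ->
  (forall k, (M <= k)%nat -> (Cmod (u (S k) - u k) <= K / INR k ^ 2 * Cmod (u k))%R) ->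
  forall k, (M <= k)%nat ->
    (Cmod (u k - u M) <= 2 * K * Cmod (u M) * (/ (INR M - 1) - / (INR k - 1)))%R.
Proof.
  intros HK HM HKM Hu k Hk. induction Hk as [|k Hk IH].
  - replace (u M - u M) with (RtoC 0) by ring. rewrite Cmod_0. lra.
  - assert (HMR : (2 <= INR M)%R) by (apply (le_INR 2) in HM; simpl in HM; lra).
    assert (HkR : (INR M <= INR k)%R) by now apply le_INR.
    assert (HuM := Cmod_ge_0 (u M)).
    assert (Hik : (0 < / (INR k - 1))%R) by (apply Rinv_0_lt_compat; lra).
    assert (HiM : (0 < / (INR M - 1))%R) by (apply Rinv_0_lt_compat; lra).
    assert (HKi : (K * / (INR M - 1) <= 1 / 4)%R).
    { apply Rle_div_l; lra. }
    assert (Huk : (Cmod (u k) <= 2 * Cmod (u M))%R).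
    { replace (u k) with ((u k - u M) + u M) by ring.
      eapply Rle_trans; [apply Cmod_triangle|].
      assert (2 * K * Cmod (u M) * (/ (INR M - 1) - / (INR k - 1)) <= Cmod (u M))%R; [|lra].
      assert (0 <= K * Cmod (u M))%R by (apply Rmult_le_pos; lra).
      nra. }
    replace (u (S k) - u M) with ((u (S k) - u k) + (u k - u M)) by ring.
    eapply Rle_trans; [apply Cmod_triangle|].
    assert (Hstep : (/ INR k ^ 2 <= / (INR k - 1) - / (INR (S k) - 1))%R).
    { rewrite S_INR.
      replace (/ (INR k - 1) - / (INR k + 1 - 1))%R
        with (/ ((INR k - 1) * INR k))%R by (field; lra).
      apply Rinv_le_contravar; nra. }
    assert (K / INR k ^ 2 * Cmod (u k) <=
            2 * K * Cmod (u M) * (/ (INR k - 1) - / (INR (S k) - 1)))%R.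
    { replace (K / INR k ^ 2 * Cmod (u k))%R
        with (K * Cmod (u k) * / INR k ^ 2)%R by (unfold Rdiv; ring).
      apply Rmult_le_compat; try assumption.
      - apply Rmult_le_pos; [assumption | apply Cmod_ge_0].
      - apply Rlt_le, Rinv_0_lt_compat. apply pow_lt; lra.
      - nra. }
    specialize (Hu k Hk). lra.
Qed.

(** From a large rank [M] on, the sequence stays within [|u M| / 2] of [u M]:
    it is thus bounded, then Cauchy, and away from [0]. *)
Lemma slowly_varying_limit (u : nat -> C) (K : R) (N : nat) :
  (0 <= K)%R ->
  (forall k, (N <= k)%nat -> (Cmod (u (S k) - u k) <= K / INR k ^ 2 * Cmod (u k))%R) ->
  (forall k, u k <> 0) ->
  exists l : C, l <> 0 /\ filterlim u eventually (locally l).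
Proof.
  intros HK Hu Hnz.
  assert (Hfar : forall A : R, exists M, (N <= M)%nat /\ (2 <= M)%nat /\ (A <= INR M - 1)%R).
  { intros A. destruct (nfloor_ex (Rabs A) (Rabs_pos A)) as [n [_ Hn]].
    exists (n + N + 2)%nat. repeat split; try lia.
    rewrite 2!plus_INR. simpl (INR 2). assert (H := Rle_abs A). assert (H' := pos_INR N). lra. }
  assert (Hdev : forall M, (N <= M)%nat -> (2 <= M)%nat -> (4 * K <= INR M - 1)%R ->
    forall k, (M <= k)%nat ->
      (Cmod (u k - u M) <= 2 * Cmod (u M) * (K / (INR M - 1)))%R).
  { intros M H1 H2 H3 k Hk.
    eapply Rle_trans.
    { apply (slowly_varying_deviation u K M HK H2 H3); [|exact Hk].
      intros i Hi. apply Hu. lia. }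
    assert (HMR : (2 <= INR M)%R) by (apply (le_INR 2) in H2; simpl in H2; lra).
    assert (HkR : (INR M <= INR k)%R) by now apply le_INR.
    assert (0 < / (INR k - 1))%R by (apply Rinv_0_lt_compat; lra).
    assert (0 <= K * Cmod (u M))%R by (apply Rmult_le_pos; [assumption | apply Cmod_ge_0]).
    unfold Rdiv. nra. }
  assert (Hdev' : forall M, (N <= M)%nat -> (2 <= M)%nat -> (4 * K <= INR M - 1)%R ->
    forall k, (M <= k)%nat -> (Cmod (u k - u M) <= Cmod (u M) / 2)%R).
  { intros M H1 H2 H3 k Hk. eapply Rle_trans; [apply Hdev; eassumption|].
    assert (HMR : (2 <= INR M)%R) by (apply (le_INR 2) in H2; simpl in H2; lra).
    assert (K / (INR M - 1) <= 1 / 4)%R by (apply Rle_div_l; lra).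
    assert (Hdv := Cmod_ge_0 (u M)). nra. }
  destruct (Hfar (4 * K)%R) as [M0 [HM1 [HM2 HM3]]].
  assert (Hpos : (0 < Cmod (u M0))%R) by (apply Cmod_gt_0, Hnz).
  assert (Hex : exists l : C_R_CompleteNormedModule, filterlim u eventually (locally l)).
  { apply (proj1 (filterlim_locally_cauchy (U := C_R_CompleteNormedModule) u)).
    intros eps. assert (He := cond_pos eps).
    destruct (Hfar (Rmax (4 * K) (12 * Cmod (u M0) * K / eps))%R) as [M [H1 [H2 H3]]].
    assert (H4 := Rmax_l (4 * K) (12 * Cmod (u M0) * K / eps)).
    assert (H5 := Rmax_r (4 * K) (12 * Cmod (u M0) * K / eps)).
    (* |u M'| <= 3/2 |u M0|, hence |u k - u M'| <= 3 |u M0| K / (M' - 1) <= eps/4 *)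
    set (M' := Nat.max M M0).
    exists (fun k => (M' <= k)%nat). split; [exists M'; trivial |].
    assert (HMR : (2 <= INR M)%R) by (apply (le_INR 2) in H2; simpl in H2; lra).
    assert (HM'R : (INR M <= INR M')%R) by (apply le_INR; lia).
    assert (HuM' : (Cmod (u M') <= 3 / 2 * Cmod (u M0))%R).
    { replace (u M') with ((u M' - u M0) + u M0) by ring.
      eapply Rle_trans; [apply Cmod_triangle|].
      assert (H := Hdev' M0 HM1 HM2 HM3 M' ltac:(lia)). lra. }
    assert (Hclose : forall k, (M' <= k)%nat -> (Cmod (u k - u M') <= eps / 4)%R).
    { intros k Hk. eapply Rle_trans; [apply Hdev; try lia; lra |].
      apply Rmult_le_reg_r with (INR M' - 1)%R; [lra|].
      replace (2 * Cmod (u M') * (K / (INR M' - 1)) * (INR M' - 1))%R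
        with (2 * Cmod (u M') * K)%R by (field; lra).
      assert (12 * Cmod (u M0) * K <= (INR M - 1) * eps)%R
        by (apply Rle_div_l; lra).
      nra. }
    intros v w Hv Hw.
    apply (C_NormedModule_mixin_compat1 (u v) (u w) eps).
    replace (minus (u w) (u v)) with (u w - u v) by reflexivity.
    replace (u w - u v) with ((u w - u M') + - (u v - u M')) by ring.
    eapply Rle_lt_trans; [apply Cmod_triangle|]. rewrite Cmod_opp.
    assert (Hv' := Hclose v Hv). assert (Hw' := Hclose w Hw). lra. }
  destruct Hex as [l Hl]. exists l. split; [|exact Hl].
  intros Hl0. apply (filterlim_C_Cmod eventually u l) with (eps := (Cmod (u M0) / 2)%R) in Hl;
    [|lra].
  destruct Hl as [n Hn].
  assert (Hk := Hn (Nat.max n M0) ltac:(lia)).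
  assert (Hd := Hdev' M0 HM1 HM2 HM3 (Nat.max n M0) ltac:(lia)).
  set (v := u (Nat.max n M0)) in *. rewrite Hl0 in Hk.
  replace (v - 0) with v in Hk by ring.
  assert (Cmod (u M0) <= Cmod v + Cmod (v - u M0))%R; [|lra].
  replace (u M0) with (v + - (v - u M0)) at 1 by ring.
  rewrite <- (Cmod_opp (v - u M0)). apply Cmod_triangle.
Qed.
(** * Powers of positive reals *)

Lemma pos_Cpow_plus (t : R) (s r : C) :
  pos_Cpow t (s + r) = pos_Cpow t s * pos_Cpow t r.
Proof.
  unfold pos_Cpow. destruct s as [a b], r as [a' b']. simpl.
  rewrite 2!Rmult_plus_distr_r, exp_plus, cos_plus, sin_plus.
  apply injective_projections; simpl; ring.
Qed.

Lemma pos_Cpow_mult (t r : R) (s : C) :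
  (0 < t)%R -> (0 < r)%R -> pos_Cpow (t * r) s = pos_Cpow t s * pos_Cpow r s.
Proof.
  intros Ht Hr. unfold pos_Cpow. rewrite ln_mult by assumption.
  rewrite 2!Rmult_plus_distr_l, exp_plus, cos_plus, sin_plus.
  apply injective_projections; simpl; ring.
Qed.

Lemma pos_Cpow_1 (t : R) : (0 < t)%R -> pos_Cpow t 1 = t.
Proof.
  intros Ht. unfold pos_Cpow. simpl.
  rewrite Rmult_1_l, Rmult_0_l, cos_0, sin_0, exp_ln by assumption.
  apply injective_projections; simpl; ring.
Qed.

Lemma pos_Cpow_0 (t : R) : pos_Cpow t 0 = 1.
Proof.
  unfold pos_Cpow. simpl. rewrite Rmult_0_l, exp_0, cos_0, sin_0.
  apply injective_projections; simpl; ring.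
Qed.

Lemma pos_Cpow_neq_0 (t : R) (s : C) : pos_Cpow t s <> 0.
Proof.
  unfold pos_Cpow. apply Cmult_neq_0.
  - intros H. apply RtoC_inj in H. assert (H' := exp_pos (Re s * ln t)). lra.
  - intros H. injection H as H1 H2.
    assert (H' := sin2_cos2 (Im s * ln t)). rewrite H1, H2 in H'.
    unfold Rsqr in H'. lra.
Qed.

(** * Pochhammer symbols off the poles *)

Lemma RtoC_INR_S (k : nat) : RtoC (INR (S k)) = INR k + 1.
Proof. now rewrite S_INR, RtoC_plus. Qed.

Lemma RtoC_fact_S (k : nat) : RtoC (INR (fact (S k))) = (INR k + 1) * INR (fact k).
Proof. now rewrite fact_simpl, mult_INR, RtoC_mult, RtoC_INR_S. Qed.

Lemma RtoC_fact_neq_0 (k : nat) : RtoC (INR (fact k)) <> 0.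
Proof. intros H. apply RtoC_inj in H. revert H. apply INR_fact_neq_0. Qed.

Lemma RtoC_INR_S_neq_0 (k : nat) : INR k + 1 <> 0.
Proof.
  rewrite <- RtoC_INR_S. intros H. apply RtoC_inj in H. revert H. apply not_0_INR. lia.
Qed.

Lemma Gamma_defined_plus_neq_0 (z : C) (k : nat) : Gamma_defined z -> z + INR k <> 0.
Proof.
  intros Hz H. apply (Hz k). replace z with (z + INR k + - INR k) by ring.
  rewrite H. ring.
Qed.

Lemma Gamma_defined_shift (z : C) (k : nat) : Gamma_defined z -> Gamma_defined (z + INR k).
Proof.
  intros Hz m H. apply (Hz (m + k)%nat). rewrite plus_INR, RtoC_plus.
  replace z with (z + INR k + - INR k) by ring. rewrite H. ring.
Qed.

Lemma Gamma_defined_Re_pos (z : C) : (0 < Re z)%R -> Gamma_defined z.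
Proof.
  intros Hz m H. rewrite H in Hz. simpl in Hz. assert (H' := pos_INR m). lra.
Qed.

Lemma poch_neq_0 (z : C) (k : nat) : Gamma_defined z -> poch z k <> 0.
Proof.
  intros Hz. induction k as [|k IH]; simpl.
  - apply C1_nz.
  - apply Cmult_neq_0; [exact IH | now apply Gamma_defined_plus_neq_0].
Qed.

Lemma poch_shift (z : C) (k : nat) : poch z (S k) = z * poch (z + 1) k.
Proof.
  induction k as [|k IH].
  - simpl. ring.
  - change (poch z (S (S k))) with (poch z (S k) * (z + INR (S k))).
    rewrite IH, RtoC_INR_S. simpl. ring.
Qed.

Lemma poch_1 (k : nat) : poch 1 k = INR (fact k).
Proof.
  induction k as [|k IH]; [reflexivity|].
  rewrite RtoC_fact_S. simpl poch. rewrite IH. ring.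
Qed.

Lemma Cinv_neq_0 (z : C) : z <> 0 -> / z <> 0.
Proof.
  intros Hz H. apply C1_nz. rewrite <- (Cinv_r z Hz), H. ring.
Qed.

(** * The Gamma function *)

Definition euler_seq (z : C) (k : nat) : C :=
  INR (fact k) * pos_Cpow (INR k) (z - 1) / poch z k.

Lemma euler_seq_neq_0 (z : C) (k : nat) : Gamma_defined z -> euler_seq z k <> 0.
Proof.
  intros Hz. unfold euler_seq, Cdiv. apply Cmult_neq_0; [apply Cmult_neq_0|].
  - apply RtoC_fact_neq_0.
  - apply pos_Cpow_neq_0.
  - now apply Cinv_neq_0, poch_neq_0.
Qed.

Lemma euler_seq_S (z : C) (k : nat) : Gamma_defined z -> (1 <= k)%nat ->
  euler_seq z (S k) = euler_seq z k * (pos_Cpow (1 + / INR k) z / (1 + z * RtoC (/ INR k))).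
Proof.
  intros Hz Hk.
  assert (HkR : (0 < INR k)%R) by (apply lt_0_INR; lia).
  assert (HkC : RtoC (INR k) <> 0) by (intros H; apply RtoC_inj in H; lra).
  assert (Hpow : forall t : R, (0 < t)%R -> pos_Cpow t (z - 1) = pos_Cpow t z / t).
  { intros t Ht. replace (pos_Cpow t z) with (pos_Cpow t (z - 1) * t).
    - field. intros H; apply RtoC_inj in H; lra.
    - rewrite <- (pos_Cpow_1 t Ht). rewrite <- pos_Cpow_plus. f_equal. ring. }
  unfold euler_seq. rewrite RtoC_fact_S.
  rewrite 2!Hpow by (try apply lt_0_INR; lia || assumption).
  replace (INR (S k)) with (INR k * (1 + / INR k))%R at 1
    by (rewrite S_INR; field; lra).
  rewrite pos_Cpow_mult by (try (assert (0 < / INR k)%R by now apply Rinv_0_lt_compat); lra).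
  rewrite RtoC_INR_S, RtoC_inv by lra. simpl poch.
  field. repeat split; try assumption.
  all: first [ now apply poch_neq_0 | apply RtoC_INR_S_neq_0
             | now apply Gamma_defined_plus_neq_0
             | rewrite Cplus_comm; now apply Gamma_defined_plus_neq_0 ].
Qed.

(** With [h = 1/k], the ratio of consecutive terms differs from [1] by
    [((1 + h)^z - (1 + z h)) / (1 + z h)], where the numerator is [O(h^2)] and
    the denominator is at least [1/2] in modulus as soon as [k >= 2 |z|]. *)
Lemma euler_seq_converges (z : C) : Gamma_defined z ->
  exists l : C, l <> 0 /\ filterlim (euler_seq z) eventually (locally l).
Proof.
  intros Hz. destruct (pos_Cpow_first_order z) as [K [HK Hpow]].
  destruct (nfloor_ex (2 * Cmod z)) as [n [_ Hn]].
  { assert (H := Cmod_ge_0 z). lra. }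
  apply slowly_varying_limit with (K := (2 * K)%R) (N := S n).
  - lra.
  - intros k Hk.
    assert (HkR : (1 <= INR k)%R) by (apply (le_INR 1); lia).
    assert (HnR : (INR n + 1 <= INR k)%R) by (rewrite <- S_INR; now apply le_INR).
    rewrite euler_seq_S by (trivial; lia).
    set (h := (/ INR k)%R).
    assert (Hh : (0 < h <= 1)%R).
    { unfold h. split; [apply Rinv_0_lt_compat; lra|].
      rewrite <- Rinv_1. apply Rinv_le_contravar; lra. }
    assert (Hzh : (Cmod z * h <= 1 / 2)%R) by (apply Rle_div_l; lra).
    assert (Hden : (1 / 2 <= Cmod (1 + z * h))%R).
    { assert (1 <= Cmod (1 + z * h) + Cmod (z * h))%R.
      { rewrite <- Cmod_1 at 1. replace (RtoC 1) with ((1 + z * h) + - (z * h)) at 1 by ring.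
        rewrite <- (Cmod_opp (z * h)). apply Cmod_triangle. }
      rewrite Cmod_mult, Cmod_R, (Rabs_pos_eq h) in H by lra. lra. }
    assert (Hden0 : 1 + z * h <> 0) by (apply Cmod_gt_0; lra).
    replace (euler_seq z k * (pos_Cpow (1 + h) z / (1 + z * h)) - euler_seq z k)
      with (euler_seq z k * ((pos_Cpow (1 + h) z - (1 + z * h)) / (1 + z * h)))
      by (field; exact Hden0).
    rewrite Cmod_mult, Rmult_comm. apply Rmult_le_compat_r; [apply Cmod_ge_0|].
    rewrite Cmod_div by exact Hden0.
    apply Rle_div_l; [lra|]. specialize (Hpow h Hh Hzh).
    replace (2 * K / INR k ^ 2)%R with (2 * (K * h ^ 2))%R by (unfold h; field; lra).
    assert (0 <= K * h ^ 2)%R by (apply Rmult_le_pos; nra). nra.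
  - intros k. now apply euler_seq_neq_0.
Qed.

Lemma is_Gamma_unique (z l : C) :
  filterlim (euler_seq z) eventually (locally l) -> Gamma z = l.
Proof.
  exact (iota_filterlim_locally (V := C_R_CompleteNormedModule) (euler_seq z) l).
Qed.

Lemma Gamma_correct (z : C) : Gamma_defined z ->
  filterlim (euler_seq z) eventually (locally (Gamma z)).
Proof.
  intros Hz. destruct (euler_seq_converges z Hz) as [l [_ Hl]].
  now rewrite (is_Gamma_unique z l Hl).
Qed.

Lemma Gamma_neq_0 (z : C) : Gamma_defined z -> Gamma z <> 0.
Proof.
  intros Hz. destruct (euler_seq_converges z Hz) as [l [Hl0 Hl]].
  now rewrite (is_Gamma_unique z l Hl).
Qed.

Lemma Gamma_1 : Gamma 1 = 1.
Proof.
  apply is_Gamma_unique. apply filterlim_ext with (fun _ : nat => RtoC 1).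
  - intros k. unfold euler_seq. rewrite poch_1.
    replace (RtoC 1 - 1) with (RtoC 0) by ring.
    rewrite pos_Cpow_0. field. apply RtoC_fact_neq_0.
  - apply filterlim_const.
Qed.

Lemma filterlim_ratio_shift (z : C) :
  filterlim (fun k => INR k / (z + INR k)) eventually (locally (RtoC 1)).
Proof.
  apply (filterlim_C_Cmod eventually). intros eps Heps.
  assert (Hz := Cmod_ge_0 z).
  destruct (nfloor_ex (Cmod z + Cmod z / eps)) as [n [_ Hn]].
  { assert (0 <= Cmod z / eps)%R; [|lra]. apply Rdiv_le_0_compat; lra. }
  exists (S n). intros k Hk. apply le_INR in Hk. rewrite S_INR in Hk.
  assert (Hd : (INR k - Cmod z <= Cmod (z + INR k))%R).
  { assert (INR k <= Cmod (z + INR k) + Cmod z)%R; [|lra].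
    rewrite <- (Rabs_pos_eq (INR k)) at 1 by apply pos_INR.
    rewrite <- Cmod_R. replace (RtoC (INR k)) with ((z + INR k) + - z) at 1 by ring.
    rewrite <- (Cmod_opp z). apply Cmod_triangle. }
  assert (0 <= Cmod z / eps)%R by (apply Rdiv_le_0_compat; lra).
  assert (Hd0 : z + INR k <> 0) by (apply Cmod_gt_0; lra).
  replace (INR k / (z + INR k) - 1) with (- z / (z + INR k)) by (field; exact Hd0).
  rewrite Cmod_div, Cmod_opp by exact Hd0.
  apply Rlt_div_l; [lra|].
  assert (Cmod z = Cmod z / eps * eps)%R by (field; lra). nra.
Qed.

(** The [k]-th term of Euler's sequence at [z + 1] is [z k / (z + k)] times the
    one at [z]. *)
Lemma Gamma_S (z : C) : Gamma_defined z -> Gamma (z + 1) = z * Gamma z.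
Proof.
  intros Hz. apply is_Gamma_unique.
  replace (z * Gamma z) with (z * Gamma z * 1) by ring.
  apply filterlim_ext_loc
    with (fun k => (z * euler_seq z k) * (INR k / (z + INR k))).
  - exists 1%nat. intros k Hk. unfold euler_seq.
    assert (HkR : (0 < INR k)%R) by (apply lt_0_INR; lia).
    replace (z + 1 - 1) with ((z - 1) + 1) by ring.
    rewrite pos_Cpow_plus, pos_Cpow_1 by assumption.
    assert (Hz0 : z <> 0).
    { replace z with (z + INR 0) by (simpl; ring). now apply Gamma_defined_plus_neq_0. }
    replace (poch (z + 1) k) with (poch z k * (z + INR k) / z).
    + field. repeat split; trivial;
        first [now apply poch_neq_0 | now apply Gamma_defined_plus_neq_0].
    + change (poch z k * (z + INR k)) with (poch z (S k)). rewrite poch_shift.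
      field. exact Hz0.
  - apply (filterlim_C_mult eventually); [|apply filterlim_ratio_shift].
    apply (filterlim_C_mult eventually); [apply filterlim_const | now apply Gamma_correct].
Qed.

Lemma Gamma_plus_INR (z : C) (n : nat) : Gamma_defined z ->
  Gamma (z + INR n) = poch z n * Gamma z.
Proof.
  intros Hz. induction n as [|n IH].
  - simpl. rewrite Cplus_0_r. ring.
  - rewrite RtoC_INR_S, Cplus_assoc, Gamma_S by now apply Gamma_defined_shift.
    rewrite IH. simpl. ring.
Qed.
(** * Finite sums *)

Lemma sum_n_C_ext (F G : nat -> C) (n : nat) :
  (forall i, (i <= n)%nat -> F i = G i) -> sum_n F n = sum_n G n.
Proof. exact (sum_n_ext_loc (G := C_AbelianMonoid) F G n). Qed.

Lemma sum_n_C_mult_l (a : C) (F : nat -> C) (n : nat) :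
  sum_n (fun i => a * F i) n = a * sum_n F n.
Proof. exact (sum_n_mult_l (K := C_Ring) a F n). Qed.

Lemma sum_n_C_plus (F G : nat -> C) (n : nat) :
  sum_n (fun i => F i + G i) n = sum_n F n + sum_n G n.
Proof. exact (sum_n_plus (G := C_AbelianMonoid) F G n). Qed.

Lemma sum_n_C_Sn (F : nat -> C) (n : nat) : sum_n F (S n) = sum_n F n + F (S n).
Proof. exact (sum_Sn (G := C_AbelianMonoid) F n). Qed.

Lemma sum_n_C_shift (F : nat -> C) (n : nat) :
  sum_n F (S n) = F O + sum_n (fun i => F (S i)) n.
Proof.
  induction n as [|n IH].
  - rewrite sum_n_C_Sn, 2!sum_O. reflexivity.
  - rewrite sum_n_C_Sn, IH, (sum_n_C_Sn (fun i => F (S i)) n).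
    symmetry. apply Cplus_assoc.
Qed.

Lemma sum_n_C_rev (F : nat -> C) (n : nat) :
  sum_n F n = sum_n (fun j => F (n - j)%nat) n.
Proof.
  induction n as [|n IH].
  - now rewrite 2!sum_O.
  - rewrite sum_n_C_Sn, sum_n_C_shift, IH, Cplus_comm. reflexivity.
Qed.

Lemma Zsum_ext (b t : Z) (F G : Z -> C) :
  (forall k, (b <= k <= t)%Z -> F k = G k) -> Zsum b t F = Zsum b t G.
Proof.
  intros H. unfold Zsum. destruct (Z.ltb_spec t b) as [|Hbt]; [reflexivity|].
  apply sum_n_C_ext. intros i Hi. apply H. lia.
Qed.

Lemma Zsum_mult_l (b t : Z) (a : C) (F : Z -> C) :
  Zsum b t (fun k => a * F k) = a * Zsum b t F.
Proof.
  unfold Zsum. destruct (t <? b)%Z; [ring | apply sum_n_C_mult_l].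
Qed.

(** * The fractional difference as a convolution *)

(** The coefficient of [X^j] in the power series of [(1 - X)^(-a)]. *)
Definition frac_coef (a : C) (j : nat) : C := poch a j / INR (fact j).

(** Compares coefficients in [(1 - X) (1 - X)^(-a) = (1 - X)^(-(a-1))]. *)
Lemma frac_coef_pascal (a : C) (j : nat) :
  frac_coef a (S j) = frac_coef (a - 1) (S j) + frac_coef a j.
Proof.
  unfold frac_coef. rewrite (poch_shift (a - 1)).
  replace (a - 1 + 1) with a by ring.
  simpl poch. rewrite RtoC_fact_S. field.
  split; [apply RtoC_fact_neq_0 | apply RtoC_INR_S_neq_0].
Qed.

(** Convolution with the coefficients of [(1 - X)^(-a)]: the sum of fractional
    order [a] of [f], started at [b]. *)
Definition frac_sum (a : C) (b : Z) (f : Z -> C) (t : Z) : C :=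
  Zsum b t (fun k => frac_coef a (Z.to_nat (t - k)) * f k).

(** Pascal's rule handles the terms with [k < t]; the last term has coefficient
    [frac_coef _ 0 = 1] for every order.  Since sums below [b] are empty, no
    boundary term appears. *)
Lemma nabla_frac_sum (a : C) (b : Z) (f : Z -> C) (t : Z) :
  nabla (frac_sum a b f) t = frac_sum (a - 1) b f t.
Proof.
  unfold nabla, frac_sum, Zsum.
  destruct (Z.ltb_spec t b) as [Htb|Htb].
  { destruct (Z.ltb_spec (t - 1) b); [ring | lia]. }
  remember (Z.to_nat (t - b)) as m eqn:Hm.
  assert (Ht : t = (b + Z.of_nat m)%Z) by lia. clear Hm Htb. subst t.
  destruct m as [|m].
  - destruct (Z.ltb_spec (b + Z.of_nat 0 - 1) b) as [_|]; [|lia].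
    rewrite 2!sum_O. replace (b + Z.of_nat 0 - (b + Z.of_nat 0))%Z with 0%Z by ring.
    unfold frac_coef. simpl. ring.
  - destruct (Z.ltb_spec (b + Z.of_nat (S m) - 1) b) as [|_]; [lia|].
    replace (Z.to_nat (b + Z.of_nat (S m) - 1 - b)) with m by lia.
    rewrite 2!sum_n_C_Sn, Z.sub_diag.
    match goal with |- (sum_n ?u m + ?x - sum_n ?v m = sum_n ?w m + _) =>
      replace (sum_n u m) with (sum_n w m + sum_n v m) end.
    + unfold frac_coef. simpl. ring.
    + rewrite <- sum_n_C_plus. apply sum_n_C_ext. intros i Hi.
      replace (Z.to_nat (b + Z.of_nat (S m) - (b + Z.of_nat i))) with (S (m - i)) by lia.
      replace (Z.to_nat (b + Z.of_nat (S m) - 1 - (b + Z.of_nat i))) with (m - i)%nat by lia.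
      rewrite (frac_coef_pascal a). ring.
Qed.

Lemma iter_nabla_frac_sum (n : nat) (a : C) (b : Z) (f g : Z -> C) (t : Z) :
  (forall s, g s = frac_sum a b f s) ->
  Nat.iter n nabla g t = frac_sum (a - INR n) b f t.
Proof.
  intros Hg. revert t. induction n as [|n IH]; intros t.
  - simpl. rewrite Hg. f_equal. ring.
  - change (nabla (Nat.iter n nabla g) t = frac_sum (a - INR (S n)) b f t).
    unfold nabla. rewrite 2!IH. fold (nabla (frac_sum (a - INR n) b f) t).
    rewrite nabla_frac_sum, RtoC_INR_S. f_equal. ring.
Qed.

Lemma diff_order_spec (mu : C) : (0 < Re (INR (diff_order mu) - mu))%R.
Proof.
  replace (Re (INR (diff_order mu) - mu)) with (INR (diff_order mu) - Re mu)%R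
    by (destruct mu; reflexivity).
  unfold diff_order. destruct (archimed (Re mu)) as [H _].
  assert (IZR (up (Re mu)) <= INR (Z.to_nat (up (Re mu))))%R; [|lra].
  rewrite INR_IZR_INZ. apply IZR_le. lia.
Qed.

Lemma Cpoch_INR (a : C) (m : nat) : (0 < Re a)%R ->
  Cpoch (INR m + 1) (a - 1) = Gamma a * frac_coef a m.
Proof.
  intros Ha. unfold Cpoch, frac_coef.
  assert (H1 : Gamma_defined 1) by (apply Gamma_defined_Re_pos; simpl; lra).
  replace (INR m + 1 + (a - 1)) with (a + INR m) by ring.
  rewrite (Cplus_comm (INR m)), 2!Gamma_plus_INR, Gamma_1, poch_1
    by (trivial; now apply Gamma_defined_Re_pos).
  field. apply RtoC_fact_neq_0.
Qed.

(** The order [n] only serves to make [n - mu] have positive real part, where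
    [Gamma] is finite and nonzero; it disappears from the result. *)
Lemma frac_nabla_frac_sum (mu : C) (b : Z) (f : Z -> C) (t : Z) :
  frac_nabla mu b f t = frac_sum (- mu) b f t.
Proof.
  unfold frac_nabla. set (n := diff_order mu).
  assert (Hre := diff_order_spec mu). fold n in Hre.
  rewrite (iter_nabla_frac_sum n (INR n - mu) b (fun k => Gamma (INR n - mu) * f k)).
  - replace (INR n - mu - INR n) with (- mu) by ring.
    replace (frac_sum (- mu) b (fun k => Gamma (INR n - mu) * f k) t)
      with (Gamma (INR n - mu) * frac_sum (- mu) b f t).
    + field. now apply Gamma_neq_0, Gamma_defined_Re_pos.
    + unfold frac_sum. rewrite <- Zsum_mult_l. apply Zsum_ext. intros; ring.
  - intros s. unfold frac_sum. apply Zsum_ext. intros k Hk.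
    replace (RtoC (IZR (s - k + 1))) with (INR (Z.to_nat (s - k)) + 1).
    + rewrite Cpoch_INR by assumption. ring.
    + rewrite plus_IZR, RtoC_plus, INR_IZR_INZ. do 3 f_equal. lia.
Qed.

(** * The finite Meixner sum *)

Lemma poch_neg_INR (x j : nat) : (j <= x)%nat ->
  poch (- INR x) j * INR (fact (x - j)) = (- (1)) ^ j * INR (fact x).
Proof.
  induction j as [|j IH]; intros Hj.
  - rewrite Nat.sub_0_r. simpl. ring.
  - rewrite Cpow_S, <- Cmult_assoc, <- IH by lia.
    replace (x - j)%nat with (S (x - S j)) by lia.
    rewrite RtoC_fact_S. simpl poch.
    replace (INR x) with (INR (x - S j) + INR j + 1)%R.
    + rewrite 2!RtoC_plus. ring.
    + rewrite <- plus_INR, <- S_INR. f_equal. lia.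
Qed.

(** Reading [(w)_x] from its last factor: the [j] factors
    [w + x - 1, ..., w + x - j] are, up to sign, those of
    [(- w - x + 1)_j]. *)
Lemma poch_reflect (w : C) (x j : nat) : (j <= x)%nat ->
  poch (- w - INR x + 1) j * poch w (x - j) = (- (1)) ^ j * poch w x.
Proof.
  induction j as [|j IH]; intros Hj.
  - rewrite Nat.sub_0_r. simpl. ring.
  - rewrite Cpow_S, <- Cmult_assoc, <- IH by lia.
    replace (x - j)%nat with (S (x - S j)) by lia. simpl poch.
    replace (INR x) with (INR (x - S j) + INR j + 1)%R.
    + rewrite 2!RtoC_plus. ring.
    + rewrite <- plus_INR, <- S_INR. f_equal. lia.
Qed.

Lemma Cpow_m1_neq_0 (j : nat) : (- (1)) ^ j <> 0.
Proof.
  apply Cpow_nz. intros H. apply C1_nz.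
  replace (RtoC 1) with (- - (1)) by ring. rewrite H. ring.
Qed.

(** Common closed form of both sides, free of Gamma factors and of
    denominators that vanish at the poles of [Gamma (b + mu)]. *)
Definition Meixner_sum (mu : C) (x : nat) (b c : C) : C :=
  / poch b x *
  sum_n (fun j : nat =>
    frac_coef (- mu) j * (INR (fact x) / INR (fact (x - j))) * (1 / c) ^ j
    * poch (b + mu) (x - j)) x.

Lemma frac_Meixner_sum (mu : C) (x : nat) (beta c : C) :
  c <> 0 -> poch beta x <> 0 -> frac_Meixner mu x beta c = Meixner_sum mu x beta c.
Proof.
  intros Hc Hb. unfold frac_Meixner, Meixner_sum.
  rewrite frac_nabla_frac_sum. unfold frac_sum, Zsum.
  destruct (Z.ltb_spec (Z.of_nat x) 0) as [|_]; [lia|].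
  rewrite Z.sub_0_r, Nat2Z.id, sum_n_C_rev, <- 2!sum_n_C_mult_l.
  apply sum_n_C_ext. intros j Hj.
  replace (0 + Z.of_nat (x - j))%Z with (Z.of_nat (x - j)) by ring.
  replace (Z.to_nat (Z.of_nat x - Z.of_nat (x - j))) with j by lia.
  rewrite Nat2Z.id.
  replace (c ^ x) with (c ^ j * c ^ (x - j)) by (rewrite <- Cpow_add_r; f_equal; lia).
  replace ((1 / c) ^ j) with (/ c ^ j)
    by (rewrite <- Cpow_inv by assumption; f_equal; field; assumption).
  field. repeat split; try assumption; try (now apply Cpow_nz); apply RtoC_fact_neq_0.
Qed.

Lemma Gamma_hypergeometric_sum (mu : C) (x : nat) (b c : C) :
  Gamma_defined b -> Gamma_defined (b + mu) ->
  (Gamma b * Gamma (b + mu + INR x)) / (Gamma (b + INR x) * Gamma (b + mu)) *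
  sum_n (fun j : nat =>
           (poch (- mu) j * poch (- INR x) j)
           / (INR (fact j) * poch (- b - mu - INR x + 1) j) * (1 / c) ^ j) x
  = Meixner_sum mu x b c.
Proof.
  intros Hb Hbm. unfold Meixner_sum. rewrite 2!Gamma_plus_INR by assumption.
  replace (Gamma b * (poch (b + mu) x * Gamma (b + mu)) /
           (poch b x * Gamma b * Gamma (b + mu)))
    with (/ poch b x * poch (b + mu) x)
    by (field; repeat split; first [now apply poch_neq_0 | now apply Gamma_neq_0]).
  rewrite <- Cmult_assoc, <- sum_n_C_mult_l. f_equal.
  apply sum_n_C_ext. intros j Hj. unfold frac_coef.
  assert (Hf := poch_neg_INR x j Hj). assert (Hp := poch_reflect (b + mu) x j Hj).
  replace (- (b + mu) - INR x + 1) with (- b - mu - INR x + 1) in Hp by ring.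
  set (q := poch (- b - mu - INR x + 1) j) in *. set (p := poch (b + mu) (x - j)) in *.
  assert (Hp0 : poch (b + mu) x <> 0) by now apply poch_neq_0.
  assert (Hs := Cpow_m1_neq_0 j). set (s := (- (1)) ^ j) in *.
  assert (Hq0 : q <> 0).
  { intros Hq. rewrite Hq, Cmult_0_l in Hp. symmetry in Hp. revert Hp.
    now apply Cmult_neq_0. }
  assert (Hf1 := RtoC_fact_neq_0 (x - j)).
  replace (poch (- INR x) j) with (s * INR (fact x) / INR (fact (x - j)))
    by (rewrite <- Hf; field; exact Hf1).
  replace (poch (b + mu) x) with (q * p / s) by (rewrite Hp; field; exact Hs).
  field. repeat split; try assumption; apply RtoC_fact_neq_0.
Qed.

(** * Behaviour near a pole *)

(** Two poles are at distance at least [1], so that at most one of them is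
    within [1/2] of [w]. *)
Lemma Gamma_poles_isolated (w : C) :
  exists d : R, (0 < d)%R /\
    forall y : C, y <> w -> (Cmod (y - w) < d)%R -> Gamma_defined y.
Proof.
  destruct (classic (exists m : nat, w <> - INR m /\ (Cmod (- INR m - w) < 1 / 2)%R))
    as [[m [Hw Hm]] | Hno].
  - exists (Cmod (- INR m - w)). split.
    { apply Cmod_gt_0. intros H. apply Hw. replace w with (- INR m - (- INR m - w)) by ring.
      rewrite H. ring. }
    intros y _ Hy k Hk. subst y.
    assert (Hkm : (Cmod (INR m - INR k) < 1)%R).
    { replace (INR m - INR k) with ((- INR k - w) + - (- INR m - w)) by ring.
      eapply Rle_lt_trans; [apply Cmod_triangle|]. rewrite Cmod_opp. lra. }
    rewrite <- RtoC_minus, Cmod_R, 2!INR_IZR_INZ, <- minus_IZR, <- abs_IZR in Hkm.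
    apply lt_IZR in Hkm. replace k with m in Hy by lia. lra.
  - exists (1 / 2)%R. split; [lra|]. intros y Hyw Hy m Hm. subst y.
    apply Hno. exists m. split; [|exact Hy]. intros H; now apply Hyw.
Qed.

Lemma locally'_Cmod (w : C) (P : C -> Prop) :
  (exists d : R, (0 < d)%R /\ forall y, y <> w -> (Cmod (y - w) < d)%R -> P y) ->
  locally' w P.
Proof.
  intros [d [Hd H]]. apply locally_C. exists (mkposreal d Hd). intros y Hy Hyw.
  now apply H.
Qed.

Lemma filterlim_poch (F : (C -> Prop) -> Prop) {FF : Filter F} (g : C -> C) (a : C) (n : nat) :
  filterlim g F (locally a) -> filterlim (fun b => poch (g b) n) F (locally (poch a n)).
Proof.
  intros Hg. induction n as [|n IH]; simpl.
  - apply filterlim_const.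
  - apply (filterlim_C_mult F); [exact IH|].
    apply (filterlim_C_plus F); [exact Hg | apply filterlim_const].
Qed.

Lemma filterlim_sum_n (F : (C -> Prop) -> Prop) {FF : Filter F} (g : nat -> C -> C)
    (l : nat -> C) (n : nat) :
  (forall j, filterlim (g j) F (locally (l j))) ->
  filterlim (fun b => sum_n (fun j => g j b) n) F (locally (sum_n l n)).
Proof.
  intros Hg. induction n as [|n IH].
  - rewrite sum_O. apply filterlim_ext with (g O); [|apply Hg].
    intros b. now rewrite sum_O.
  - rewrite sum_n_C_Sn.
    apply filterlim_ext with (fun b => sum_n (fun j => g j b) n + g (S n) b).
    + intros b. now rewrite sum_n_C_Sn.
    + now apply (filterlim_C_plus F).
Qed.

Lemma filterlim_Meixner_sum (mu : C) (x : nat) (beta c : C) : poch beta x <> 0 ->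
  filterlim (fun b => Meixner_sum mu x b c) (locally' beta)
    (locally (Meixner_sum mu x beta c)).
Proof.
  intros Hb. unfold Meixner_sum.
  assert (Hid : filterlim (fun b : C => b) (locally' beta) (locally beta)).
  { exact (filter_le_within (F := locally beta) _). }
  apply (filterlim_C_mult (locally' beta)).
  - apply (filterlim_C_inv (locally' beta)); [exact Hb |].
    now apply (filterlim_poch (locally' beta) (fun b => b)).
  - apply (filterlim_sum_n (locally' beta)). intros j.
    apply (filterlim_C_mult (locally' beta)); [apply filterlim_const|].
    apply (filterlim_poch (locally' beta)). apply (filterlim_C_plus (locally' beta)); [exact Hid|].
    apply filterlim_const.
Qed.

(** * The fractional Meixner function *)

Theorem proposition3p21 (c beta mu : C) (x : nat) (hc : c <> 0) :
  let rhs (b : C) : C :=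
    (Gamma b * Gamma (b + mu + INR x)) / (Gamma (b + INR x) * Gamma (b + mu)) *
    sum_n (fun j : nat =>
             (poch (- mu) j * poch (- INR x) j)
             / (INR (fact j) * poch (- b - mu - INR x + 1) j) * (1 / c) ^ j) x in
  (Gamma_defined beta -> Gamma_defined (beta + mu) ->
     frac_Meixner mu x beta c = rhs beta) /\
  (poch beta x <> 0 ->
     filterlim rhs (locally' beta) (locally (frac_Meixner mu x beta c))).
Proof.
  intros rhs. split.
  - intros Hb Hbm. unfold rhs. rewrite Gamma_hypergeometric_sum by assumption.
    apply frac_Meixner_sum; [exact hc | now apply poch_neq_0].
  - intros Hb. rewrite frac_Meixner_sum by assumption.
    apply filterlim_ext_loc with (fun b => Meixner_sum mu x b c);
      [|now apply filterlim_Meixner_sum].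
    apply locally'_Cmod.
    destruct (Gamma_poles_isolated beta) as [d1 [Hd1 H1]].
    destruct (Gamma_poles_isolated (beta + mu)) as [d2 [Hd2 H2]].
    exists (Rmin d1 d2). split; [now apply Rmin_pos|]. intros y Hy Hyd.
    unfold rhs. rewrite Gamma_hypergeometric_sum; [reflexivity | |].
    + apply H1; [exact Hy|]. eapply Rlt_le_trans; [exact Hyd | apply Rmin_l].
    + apply H2.
      * intros H. apply Hy. replace y with (y + mu - mu) by ring. rewrite H. ring.
      * replace (y + mu - (beta + mu)) with (y - beta) by ring.
        eapply Rlt_le_trans; [exact Hyd | apply Rmin_r].
Qed.
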